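(* Let $(C,\phi)$ be a multistate monotone system and $k\in\{1,\ldots,M\}$. For $\bm{y}\in\mathfrak{C}\setminus\{\bm{0}\}$ let $A(\bm{y})=\{i:y_i>0\}$, and define the binary monotone system $(A(\bm{y}),\psi_k^{\bm{y}})$ by $$\psi_k^{\bm{y}}(\bm{z})=\phi_k\big(\bm{y}-(\bm{1}^{A(\bm{y})},\bm{0})+(\bm{z},\bm{0})\big),\qquad \bm{z}\in\{0,1\}^{A(\bm{y})},$$ where $(\bm{z},\bm{0})$ is the vector in $\{0,1\}^n$ whose entries indexed by $A(\bm{y})$ are given by $\bm{z}$ and whose other entries are $0$, and $(\bm{1}^{A(\bm{y})},\bm{0})$ is the indicator vector of $A(\bm{y})$. Then $\delta_k(\bm{y})=d(\psi_k^{\bm{y}})$.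
   Context: A multistate monotone system (MMS) $(C,\phi)$ has component set $C=\{1,\ldots,n\}$, component state sets $\mathcal{S}_i=\{0,1,\ldots,m_i\}$, component state space $\mathfrak{C}=\mathcal{S}_1\times\cdots\times\mathcal{S}_n$, system state set $\{0,1,\ldots,M\}$, and a structure function $\phi:\mathfrak{C}\to\{0,\ldots,M\}$ non-decreasing in each argument; $\phi_k(\bm{x})=\mathrm{I}(\phi(\bm{x})\ge k)$. Vectors are ordered componentwise. For a binary-valued non-decreasing function $f$ on a product of state sets, a minimal path vector is $\bm{x}$ with $f(\bm{x})=1$ and $f(\bm{y})=0$ for all $\bm{y}\le\bm{x}$, $\bm{y}\ne\bm{x}$; with $\mathfrak{P}$ the set of these, $\mathrm{cl}(\mathfrak{P})$ is the smallest set containing $\mathfrak{P}$ closed under componentwise maximum. A formation of $\bm{x}\in\mathrm{cl}(\mathfrak{P})$ is a nonempty subset $\{\bm{x}_{i_1},\ldots,\bm{x}_{i_j}\}\subseteq\mathfrak{P}$ whose componentwise maximum is $\bm{x}$, odd/even according to parity of $j$. The signed domination function is $\delta(\bm{x})=$ (number of odd formations) $-$ (number of even formations) on $\mathrm{cl}(\mathfrak{P})$ and $0$ elsewhere; $\delta_k$ denotes this function for $f=\phi_k$. The signed domination $d(f)$ is $\delta$ evaluated at the maximal state vector; for the binary system $\psi_k^{\bm{y}}$ (component state sets $\{0,1\}$) this is the all-ones vector on $A(\bm{y})$. *)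

(* Defs.v *)
From HB Require Import structures.
From mathcomp Require Import all_boot all_order all_algebra.

Set Implicit Arguments.
Unset Strict Implicit.
Unset Printing Implicit Defensive.

Import Order.TTheory.

Section StateVectors.
Variables (I : finType) (m : I -> nat).

Definition states := {dffun forall i : I, 'I_(m i).+1}.

Definition vzero : states := [ffun i => ord0].
Definition vtop : states := [ffun i => ord_max].
Definition vmax (x y : states) : states := [ffun i => Order.max (x i) (y i)].
Definition vle (x y : states) : bool := [forall i, x i <= y i].

Definition nondecreasing_in_each d (T : porderType d) (f : states -> T) : Prop :=
  forall (i : I) (x y : states),
    (forall j, j != i -> x j = y j) -> x i <= y i -> (f x <= f y)%O.

Record mms (M : nat) := MMS {
  structure_fun :> states -> 'I_M.+1;
  structure_funP : nondecreasing_in_each structure_fun }.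

(* With m = fun=> 1 this is a binary monotone system on I. *)
Record mbf := MBF {
  mbf_fun :> states -> bool;
  mbf_funP : nondecreasing_in_each mbf_fun }.

Lemma level_subproof M (phi : mms M) (k : nat) :
  nondecreasing_in_each (fun x => k <= phi x).
Proof.
move=> i x y exy lexy; have lephi := structure_funP phi exy lexy.
by rewrite leEbool; case: (leqP k (phi x)) => //= kx; rewrite (leq_trans kx lephi).
Qed.
Definition level M (phi : mms M) (k : nat) : mbf := MBF (level_subproof phi k).

Section Domination.
Variable f : mbf.

Definition min_path_vectors : {set states} :=
  [set x | f x & [forall y, vle y x && (y != x) ==> ~~ f y]].

Definition vmax_closed (S : {set states}) : bool :=
  [forall x in S, forall y in S, vmax x y \in S].

Definition cl (P : {set states}) : {set states} :=
  \bigcap_(S : {set states} | (P \subset S) && vmax_closed S) S.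

(* vzero is neutral for vmax, so for nonempty F the iterated operation is the
   componentwise maximum of F. *)
Definition formation (x : states) (F : {set states}) : bool :=
  [&& F != set0, F \subset min_path_vectors &
      \big[vmax/vzero]_(p in F) p == x].

Definition signed_domination_fun (x : states) : int :=
  if x \in cl min_path_vectors then
    (#|[set F | formation x F & odd #|F|]|%:Z
     - #|[set F | formation x F & ~~ odd #|F|]|%:Z)%R
  else 0%R.

Definition signed_domination : int := signed_domination_fun vtop.

End Domination.
End StateVectors.

Section InducedBinarySystem.
Variables (I : finType) (m : I -> nat).

Definition supp (y : states m) : {set I} := [set i | 0 < y i].

Definition binary_states (A : {set I}) := states (fun _ : {i | i \in A} => 1).

(* The i-th entry of (z, 0). *)
Definition pad0 (A : {set I}) (z : binary_states A) (i : I) : nat :=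
  if insub i is Some j then z j else 0.

Lemma pad0_le (A : {set I}) (z : binary_states A) i : pad0 z i <= (i \in A).
Proof.
by rewrite /pad0; case: insubP => //= j iA _; rewrite iA -ltnS ltn_ord.
Qed.

Lemma pad0_top (A : {set I}) i : pad0 (vtop _ : binary_states A) i = (i \in A).
Proof.
by rewrite /pad0; case: insubP => [j iA _|/negbTE->//]; rewrite ffunE iA.
Qed.

Lemma lower_subproof (y : states m) (z : binary_states (supp y)) (i : I) :
  y i - pad0 (vtop _ : binary_states (supp y)) i + pad0 z i < (m i).+1.
Proof.
rewrite pad0_top; have := pad0_le z i; rewrite inE => lez.
apply: leq_trans (ltn_ord (y i)); rewrite ltnS.
by rewrite -[leqRHS](@subnK (0 < y i)) ?leq_add2l //; case: (nat_of_ord (y i)).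
Qed.

(* y - (1^A(y), 0) + (z, 0); the subtraction on nat never truncates, since
   y i > 0 for i in A(y) = supp y. *)
Definition lower (y : states m) (z : binary_states (supp y)) : states m :=
  [ffun i => Ordinal (lower_subproof z i)].

Lemma psi_subproof M (phi : mms m M) (k : nat) (y : states m) :
  nondecreasing_in_each
    (fun z : binary_states (supp y) => level phi k (lower z)).
Proof.
move=> i z w ezw lezw; apply: (mbf_funP (level phi k) (i := val i)).
  move=> j ji; apply/val_inj; rewrite !ffunE /=; congr (_ + _).
  rewrite /pad0; case: insubP => //= j' _ j'j; congr (nat_of_ord _).
  by apply: ezw; apply: contraNneq ji => e; rewrite -j'j e.
by rewrite !ffunE /= leq_add2l /pad0 valK.
Qed.

Definition psi M (phi : mms m M) (k : nat) (y : states m) :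
    mbf (fun _ : {i | i \in supp y} => 1) :=
  MBF (psi_subproof phi k (y := y)).

End InducedBinarySystem.

(* Main.v *)
Require Import Defs.
From mathcomp Require Import all_boot all_order all_algebra.

(** Counting sets of minimal path vectors by their joins gives
    [f x = \sum_(z <= x) delta z]: the sets whose join is below [x] are the
    subsets of the minimal path vectors below [x], and their alternating sum
    only detects whether there is one. Moebius inversion on the product of
    chains expresses [delta x] as the alternating sum of [f (x - 1_B)] over
    the subsets [B] of the support of [x]. For [x = y] and for the top vector
    of the induced binary system, these two sums coincide term by term. *)

Set Implicit Arguments.
Unset Strict Implicit.
Unset Printing Implicit Defensive.

Import Order.TTheory GRing.Theory.

Section MoebiusInversion.
Local Open Scope ring_scope.

(** Expand the product over all [i] of [a i + 1], with [a i = -1] on [A] and [0] elsewhere: subsets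
    of [A] contribute their sign, other sets [0]. A single element of [A] makes a factor vanish. *)
Lemma sum_sign_subset (T : finType) (A : {set T}) :
  \sum_(B : {set T} | B \subset A) (-1) ^+ #|B| = (A == set0)%:Z :> int.
Proof.
have := @bigA_distr int 0 1 *%R +%R T (fun i => if i \in A then -1 else 0)
          (fun=> 1).
rewrite (eq_bigr (fun i => if i \in A then 0 else 1)); last first.
  by move=> i _; case: ifP => _; rewrite ?addNr ?add0r.
move=> E; transitivity (\prod_(i : T) (if i \in A then 0 else 1) : int).
  rewrite E big_mkcond; apply: eq_bigr => B _; rewrite -big_mkcond /=.
  case: ifPn => [/subsetP BA | /subsetPn[i iB iA]].
    by rewrite -prodr_const; apply: eq_bigr => i /BA ->.
  by rewrite (bigD1 i) //= (negbTE iA) mul0r.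
have [->|[i iA]] := set_0Vmem A.
  by rewrite eqxx big1 // => i _; rewrite inE.
rewrite (bigD1 i) //= iA mul0r; case: eqP => // A0.
by rewrite A0 inE in iA.
Qed.

Section StateVectors.
Variables (I : finType) (m : I -> nat).
Implicit Types (x y z : states m) (F : {set states m}) (f : mbf m).

Definition vjoin F : states m := \big[@vmax I m/@vzero I m]_(p in F) p.

Lemma states_inj x y : (forall i, x i = y i :> nat) -> x = y.
Proof. by move=> e; apply/ffunP => i; apply/val_inj/e. Qed.

Lemma vmaxE x y i : vmax x y i = maxn (x i) (y i) :> nat.
Proof. by rewrite ffunE maxEle leEord; case: leqP. Qed.

Lemma vle_vmax x y z : vle (vmax x y) z = vle x z && vle y z.
Proof.
apply/forallP/andP => [le|[/forallP lex /forallP ley] i].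
  by split; apply/forallP => i; have := le i; rewrite vmaxE geq_max => /andP[].
by rewrite vmaxE geq_max lex ley.
Qed.

Lemma vle_vjoin F z : vle (vjoin F) z = [forall p in F, vle p z].
Proof.
rewrite /vjoin (big_morph (fun x => vle x z) (id1 := true)
                  (op1 := andb)) => [|x y|].
- by rewrite big_andE.
- exact: vle_vmax.
- by apply/forallP => i; rewrite ffunE.
Qed.

(** Monotonicity is assumed one coordinate at a time, hence the induction on the number of
    coordinates where [x] and [y] differ. *)
Lemma mbf_homo f x y : vle x y -> f x -> f y.
Proof.
have [N] := ubnP #|[set i | x i != y i]|; elim: N x => // N IH x ltN lexy fx.
have [e|[i ixy]] := set_0Vmem [set i | x i != y i].
  suff <- : x = y by [].
  apply/ffunP => i; apply/eqP/negbNE.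
  by move/setP/(_ i): e; rewrite !inE => ->.
pose x' : states m := [ffun j => if j == i then y j else x j].
apply: (IH x').
- rewrite -ltnS; apply: leq_trans ltN; rewrite ltnS.
  apply/proper_card/properP; split.
    apply/subsetP => j; rewrite !inE !ffunE.
    by case: (j == i) => //; rewrite eqxx.
  by exists i => //; rewrite !inE !ffunE !eqxx.
- apply/forallP => j; rewrite ffunE; case: eqP => // _.
  exact: (forallP lexy).
- suff : (f x <= f x')%O by rewrite leEbool fx; case: (f x').
  apply: (mbf_funP f (i := i)) => [j /negbTE ji|]; rewrite ffunE ?ji // eqxx.
  exact: (forallP lexy).
Qed.

Lemma mbf_min_path f x :
  f x = [exists p in min_path_vectors f, vle p x].
Proof.
apply/idP/existsP => [fx|[p /andP[]]]; last first.
  by rewrite inE => /andP[fp _] lepx; apply: mbf_homo fp.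
have px : f x && vle x x by rewrite fx; apply/forallP.
(* A path vector below [x] with least coordinate sum is minimal: one below it has the same sum,
   hence the same coordinates. *)
case: (arg_minnP (P := fun z => f z && vle z x) (fun z => \sum_i z i)%N px).
move=> p /andP[fp lepx] minp; exists p; rewrite lepx andbT inE fp /=.
apply/forallP => z; apply/implyP => /andP[lezp neq]; apply/negP => fz.
have lezx : vle z x.
  apply/forallP => i; apply: leq_trans (forallP lepx i).
  exact: (forallP lezp).
have le : (\sum_i p i <= \sum_i z i)%N by apply: minp; rewrite fz.
case/negP: neq; apply/eqP/states_inj => i; apply/eqP.
have [lezps eqs] : (\sum_i z i <= \sum_i p i
                      ?= iff [forall i, z i == p i :> nat])%N.
  by apply: leqif_sum => j _; split=> //; apply: (forallP lezp).
by move: eqs; rewrite eqn_leq le lezps => /esym/forallP.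
Qed.

(** This makes the case distinction in [signed_domination_fun] harmless: outside the closure there
    are no formations to count. *)
Lemma formation_in_cl f x F : formation f x F -> x \in cl (min_path_vectors f).
Proof.
case/and3P => F0 FP /eqP <-; apply/bigcapP => S /andP[PS /forall_inP clS].
have {PS FP}/subsetP FS := subset_trans FP PS.
case/set0Pn: F0 => p0 p0F.
(* The iterated join starts at [vzero], which may lie outside [S]. Absorbing a member [p0] of [F]
   makes the induction start at [p0] instead. *)
have e : vmax p0 (vjoin F) = vjoin F.
  apply: states_inj => i.
  have /forallP/(_ i) : vle p0 (vjoin F).
    have : vle (vjoin F) (vjoin F) by apply/forallP.
    by rewrite vle_vjoin => /forall_inP; apply.
  by rewrite vmaxE => /maxn_idPr.
rewrite -/(vjoin F) -e /vjoin.
elim/big_rec: _ => [|p q pF H].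
  suff -> : vmax p0 (vzero m) = p0 by apply: FS.
  by apply: states_inj => i; rewrite vmaxE ffunE maxn0.
have -> : vmax p0 (vmax p q) = vmax p (vmax p0 q).
  by apply: states_inj => i; rewrite !vmaxE maxnCA.
exact: (forall_inP (clS _ (FS _ pF)) _ H).
Qed.

Lemma signed_dominationE f x :
  signed_domination_fun f x = - \sum_(F | formation f x F) (-1) ^+ #|F|.
Proof.
rewrite /signed_domination_fun; case: ifPn => [_|xcl]; last first.
  rewrite big_pred0 ?oppr0 // => F.
  by apply: contraNF xcl; apply: formation_in_cl.
have sumE (Q : pred {set states m}) (c : int) :
    (forall F, Q F -> (-1) ^+ #|F| = c) ->
    \sum_(F | Q F) (-1) ^+ #|F| = c * #|[set F | Q F]|%:Z.
  by move=> cE; rewrite (eq_bigr _ cE) sumr_const cardsE -mulr_natr natz.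
rewrite (bigID (fun F => odd #|F|)) /=.
rewrite (sumE _ (-1)) => [|F /andP[_ oF]]; last by rewrite -signr_odd oF.
rewrite (sumE _ 1) => [|F /andP[_ /negbTE oF]]; last by rewrite -signr_odd oF.
by rewrite mulN1r mul1r opprD opprK.
Qed.

Lemma mbf_sum_formations f x :
  (f x)%:Z = - \sum_(F | [&& F != set0, F \subset min_path_vectors f &
                             vle (vjoin F) x]) (-1) ^+ #|F|.
Proof.
pose Px := [set p in min_path_vectors f | vle p x].
(* The empty set contributes [1], so the nonempty subsets of [Px] sum to [-1] if [Px] is nonempty
   and to [0] otherwise. *)
have := sum_sign_subset Px; rewrite (bigD1 set0) ?sub0set //= cards0 expr0.
rewrite (eq_bigl (fun F => [&& F != set0, F \subset min_path_vectors f &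
                               vle (vjoin F) x])) => [E|F].
  have -> : f x = (Px != set0).
    rewrite mbf_min_path; apply/existsP/set0Pn => -[p].
      by exists p; rewrite inE.
    by rewrite inE; exists p.
  by apply: (addrI (-1)); rewrite -opprD E; case: eqP.
rewrite andbC vle_vjoin; congr andb.
apply/subsetP/andP => [H|[/subsetP FP /forall_inP lex] p pF].
  by split; [apply/subsetP|apply/forall_inP] => p /H; rewrite inE => /andP[].
by rewrite inE FP ?lex.
Qed.

Lemma decr_subproof x (B : {set I}) i : (x i - (i \in B) < (m i).+1)%N.
Proof. exact: leq_ltn_trans (leq_subr _ _) (ltn_ord _). Qed.
(** The subtraction is truncated, but exact for the sets [B] inside [supp x], over which the sums
    below run. *)
Definition decr x (B : {set I}) : states m :=
  [ffun i => Ordinal (decr_subproof x B i)].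

(** For [z] below [x], the sets [B] in range are the subsets of the set where [z i < x i], which is
    empty only if [z = x]. For other [z] the range is empty. *)
Lemma sum_sign_decr x z :
  \sum_(B : {set I} | (B \subset supp x) && vle z (decr x B)) (-1) ^+ #|B|
  = (z == x)%:Z :> int.
Proof.
case lezx: (vle z x); last first.
  rewrite big_pred0 => [|B].
    by case: eqP lezx => // -> /negP[]; apply/forallP.
  apply/negbTE; rewrite negb_and; apply/orP; right.
  apply: contraFN lezx => /forallP le; apply/forallP => i.
  by apply: leq_trans (le i) _; rewrite ffunE leq_subr.
move/forallP in lezx.
rewrite (eq_bigl (fun B : {set I} => B \subset [set i | z i < x i]%N)) => [|B].
  rewrite sum_sign_subset; congr (nat_of_bool _)%:Z.
  apply/eqP/eqP => [e|->]; last by apply/setP => i; rewrite !inE ltnn.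
  apply: states_inj => i; apply/eqP; rewrite eqn_leq lezx leqNgt.
  by move/setP/(_ i): e; rewrite !inE => ->.
apply/andP/subsetP => [[/subsetP Bx /forallP le] i iB|H].
  have := le i; have := Bx i iB; rewrite !inE ffunE /= iB.
  by case: (nat_of_ord (x i)) => // u _; rewrite subn1.
split.
  by apply/subsetP => i /H; rewrite !inE; apply: leq_ltn_trans.
apply/forallP => i; rewrite ffunE /=; case: (boolP (i \in B)) => [/H|_].
  by rewrite inE subn1; case: (nat_of_ord (x i)).
by rewrite subn0.
Qed.

(** Expand each [f (decr x B)] over sets [F] and exchange the sums: by [sum_sign_decr] at
    [z = vjoin F], only the [F] with join [x] survive. *)
Lemma signed_domination_moebius f x :
  signed_domination_fun f x =
  \sum_(B : {set I} | B \subset supp x) (-1) ^+ #|B| * (f (decr x B))%:Z.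
Proof.
rewrite signed_dominationE.
under [RHS]eq_bigr => B _ do
  rewrite mbf_sum_formations mulrN big_distrr /=
          (eq_bigl _ _ (fun=> andbA _ _ _)).
rewrite sumrN; congr (- _).
under [RHS]eq_bigr => B _ do rewrite big_mkcondr.
rewrite [RHS]exchange_big /= /formation.
rewrite (eq_bigl _ _ (fun=> andbA _ _ _)) big_mkcondr.
apply: eq_bigr => F _; rewrite -big_mkcondr /=.
under [RHS]eq_bigr => B _ do rewrite mulrC.
rewrite -big_distrr /= sum_sign_decr /vjoin.
by case: eqP => _; rewrite ?mulr1 ?mulr0.
Qed.

End StateVectors.

(** On the support, [y i - 1 + (1 - b) = y i - b] for a bit [b], since [y i] is positive; elsewhere
    nothing is changed. *)
Lemma lower_decr_vtop (I : finType) (m : I -> nat) (y : states m)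
    (B : {set {i | i \in supp y}}) :
  lower (decr (vtop (fun=> 1%N)) B) = decr y (val @: B).
Proof.
apply: states_inj => i; rewrite !ffunE /= pad0_top /pad0.
case: insubP => [j iA ji|iA].
  rewrite !ffunE /= -ji mem_imset ?valP //=; last exact: val_inj.
  have := valP j; rewrite inE ffunE /= => y0; rewrite y0 addnBA ?leq_b1 //.
  by rewrite subnK.
have /negbTE -> : i \notin val @: B.
  by apply: contraNN iA => /imsetP[j _ ->]; apply: valP.
by rewrite (negbTE iA) addn0.
Qed.

End MoebiusInversion.

Theorem theorem5p2 (n : nat) (m : 'I_n -> nat) (M : nat) (phi : mms m M)
    (k : nat) (hk : 1 <= k <= M) (y : states m) (hy : y != vzero m) :
  signed_domination_fun (level phi k) y = signed_domination (psi phi k y).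
Proof.
rewrite /signed_domination !signed_domination_moebius.
pose h (B : {set {i | i \in supp y}}) := val @: B.
pose h' (C : {set 'I_n}) : {set {i | i \in supp y}} := [set j | val j \in C].
(* Subsets of [supp y] are matched with sets over the subtype by image and preimage under [val]. *)
rewrite (reindex_onto h h') /= => [|C /subsetP CA]; last first.
  apply/setP => i; apply/imsetP/idP => [[j]|iC]; first by rewrite inE => ? ->.
  by exists (Sub i (CA _ iC)); rewrite ?inE ?SubK.
have hK B : h' (h B) = B.
  by apply/setP => j; rewrite inE mem_imset //; apply: val_inj.
apply: eq_big => [B|B _].
  (* Neither range restricts [B]: its image lies in [supp y], and the binary top vector has full
     support. *)
  rewrite hK eqxx andbT; transitivity true.
    by apply/subsetP => i /imsetP[j _ ->]; apply: valP.
  by apply/esym/subsetP => j _; rewrite inE ffunE.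
by rewrite card_imset ?lower_decr_vtop //; apply: val_inj.
Qed.
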